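(* Equip the set $\mathcal T_{ш}(\mathcal V)$ of shuffle tree monomials on the four binary generators $\mathcal V=\{\succ',\prec',\succ,\prec\}$, where $\prec=\prec_\bullet$, $\succ=\succ_\bullet$, $\prec'=\prec_{\bullet'}$, $\succ'=\succ_{\bullet'}$, with the leaf-lexicographic-path order in which $\succ'>\prec'>\succ>\prec$. Then the set of relations $\mathrm{DSu}(R_{Pre\text{-}Lie})=R_{LDend}$ of the operad $LDend$ of L-dendriform algebras, namely the set of the nine elements (with $\ast=\prec+\succ$, $\ast'=\prec'+\succ'$) $$\begin{aligned} &\prec(\prec(1,2),3)-\prec(1,\ast(2,3))-\prec(\prec(1,3),2)+\prec(1,\ast'(2,3)),\\ &\prec(\succ(1,2),3)-\succ(1,\prec(2,3))-\succ(\ast(1,3),2)+\succ(1,\prec'(2,3)),\\ &\succ(\ast(1,2),3)-\succ(1,\succ(2,3))-\prec(\succ(1,3),2)+\succ(1,\succ'(2,3)),\\ &\prec(\prec'(1,2),3)-\prec'(1,\ast(2,3))-\prec'(\prec(1,3),2)+\prec'(\prec'(1,3),2),\\ &\prec(\succ'(1,2),3)-\succ'(1,\prec(2,3))-\succ'(\ast(1,3),2)+\succ'(\ast'(1,3),2),\\ &\succ(\ast'(1,2),3)-\succ'(1,\succ(2,3))-\prec'(\succ(1,3),2)+\prec'(\succ'(1,3),2),\\ &\prec'(\prec'(1,2),3)-\prec'(\prec(1,2),3)-\prec'(1,\ast'(2,3))+\prec(\prec'(1,3),2),\\ &\prec'(\succ'(1,2),3)-\prec'(\succ(1,2),3)-\succ'(1,\prec'(2,3))+\succ(\ast'(1,3),2),\\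 &\succ'(\ast'(1,2),3)-\succ'(\ast(1,2),3)-\succ'(1,\succ'(2,3))+\prec(\succ'(1,3),2), \end{aligned}$$ is a Gröbner-Shirshov basis in the free shuffle operad $\mathbf k\mathcal T_{ш}(\mathcal V)$.
   Context: $\mathbf k$ is a field. For a set $\mathcal V$ of binary generators, a tree monomial is a planar rooted binary tree with vertices decorated by $\mathcal V$ and leaves labelled bijectively by $1,\dots,n$ (the trivial tree $|$ is included). Each edge is labelled by the minimum of the leaf labels above it; the tree is a shuffle tree monomial if at every vertex the input labels increase from left to right. $\mathcal T_{ш}(\mathcal V)$ denotes the set of shuffle tree monomials; $\mathbf k\mathcal T_{ш}(\mathcal V)$ is the free shuffle operad on $\mathcal V$. Trees are written functionally, e.g. $\alpha(\beta(1,3),2)$ has root $\alpha$ with left child $\beta$ (having leaves $1,3$) and right input the leaf $2$. The nine relations are $\mathrm{DSu}_i(K),\mathrm{DSu}_i(S),\mathrm{DSu}_i(T)$, $i=1,2,3$, where $K,S,T$ are the relations of the operad of right pre-Lie algebras with $\bullet'=\bullet^{(12)}$: $K=\bullet(\bullet(1,2),3)-\bullet(1,\bullet(2,3))+\bullet(1,\bullet'(2,3))-\bullet(\bullet(1,3),2)$, $S=\bullet(\bullet'(1,2),3)-\bullet'(1,\bullet(2,3))+\bullet'(\bullet'(1,3),2)-\bullet'(\bullet(1,3),2)$, $T=\bullet'(\bullet'(1,2),3)-\bullet'(\bullet(1,2),3)-\bullet'(1,\bullet'(2,3))+\bullet(\bullet'(1,3),2)$, and $\mathrm{DSu}_x(t)$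 replaces the decoration $\omega$ of each vertex on the path from the root to leaf $x$ by $\prec_\omega$ if the path turns left there and by $\succ_\omega$ if it turns right, and replaces the decoration $\omega$ of every other vertex by $\prec_\omega+\succ_\omega$. The symmetric group action is $\prec_\bullet^{(12)}=\succ_{\bullet'}$, $\succ_\bullet^{(12)}=\prec_{\bullet'}$. A (right) L-dendriform algebra is a vector space with bilinear operations $\prec,\succ$ satisfying $(x\succ y)\prec z+x\succ(z\succ y)=x\succ(y\prec z)+(x\ast z)\succ y$ and $(x\prec y)\prec z+x\prec(z\ast y)=x\prec(y\ast z)+(x\prec z)\prec y$, where $x\ast y=x\prec y+x\succ y$. Leaf-lexicographic-path order on $\mathcal T_{ш}(\mathcal V)$, $\mathcal V$ well-ordered: first compare the sequences of leaf labels read from left to right in the planar tree, in reverse degree-lexicographic order: the longer sequence is larger, and for equal length the sequence having the smaller entry at the first position where they differ is larger (so $123>132$). If these are equal, compare path sequences, i.e. the sequences, indexed by leaf labels $1,2,\dots$, of words of vertex decorations along the path from the root to that leaf; these are compared word by word (first differing word decides), words being compared degree-lexicographically. $\bar f$ denotes the leading monomial of $f$. Gröbner-Shirshov basis: a $\star$-tree $q$ of arity type $n$ is a shuffle tree having exactly one vertex decorated by an extra symbol $\star_n$ with $n$ inputs (all other vertices decorated by $\mathcal V$); for a shuffle tree $u$ with $n$ leaves, $q|_u$ is obtained by replacing that vertex by $u$, the $k$-th input from the left of the $\star_n$-vertex being attached at the leaf of $u$ labelled $k$ (extended linearly in $u$). $a\circ_i b$ denotes a shuffle composition: graft the root of $b$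 on leaf $i$ of $a$ and relabel leaves so that the result is a shuffle tree and the relative orders of the labels of $b$, and of the labels of $a$ with $i$ replaced by the minimum of the labels of $b$, are preserved. For monic $f,g$: (i) if there are shuffle trees $u,v,w$ with $w=\bar f\circ_i u=v\circ_j\bar g$ and $\max\{|V(\bar f)|,|V(\bar g)|\}<|V(w)|<|V(\bar f)|+|V(\bar g)|$ ($|V(\cdot)|$ is the number of vertices), then $(f,g)_w:=f\circ_i u-v\circ_j g$ (same shuffle compositions) is an intersection composition; (ii) if $w=\bar f=q|_{\bar g}$ for a $\star$-tree $q$, then $(f,g)_w:=f-q|_g$ is an including composition. A composition $(f,g)_w$ is trivial modulo $(S,w)$ if $(f,g)_w=\sum_i c_i q_i|_{s_i}$ (finite sum) with $c_i\in\mathbf k\setminus\{0\}$, $s_i\in S$, $q_i$ a $\star$-tree and $q_i|_{\overline{s_i}}<w$. A set $S$ of monic polynomials is a Gröbner-Shirshov basis if, for all $f,g\in S$, all intersection and including compositions $(f,g)_w$ are trivial modulo $(S,w)$. *)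

(* Defs.v *)
From HB Require Import structures.
From mathcomp Require Import all_boot all_algebra.
From mathcomp Require Export freeg.

Set Implicit Arguments.
Unset Strict Implicit.
Unset Printing Implicit Defensive.

Import GRing.Theory.
Local Open Scope ring_scope.

Inductive tree (V : Type) : Type :=
| Leaf of nat
| Node of V & tree V & tree V.

Arguments Leaf {V} _.

Section TreeChoice.
Variable V : choiceType.

Fixpoint tree_code (t : tree V) : GenTree.tree (nat + V) :=
  match t with
  | Leaf i => GenTree.Leaf (inl i)
  | Node v l r =>
      GenTree.Node 0 [:: GenTree.Leaf (inr v); tree_code l; tree_code r]
  end.

Fixpoint tree_decode (c : GenTree.tree (nat + V)) : option (tree V) :=
  match c with
  | GenTree.Leaf (inl i) => Some (Leaf i)
  | GenTree.Node _ [:: GenTree.Leaf (inr v); l; r] =>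
      if (tree_decode l, tree_decode r) is (Some l', Some r')
      then Some (Node v l' r') else None
  | _ => None
  end.

Lemma tree_codeK : pcancel tree_code tree_decode.
Proof. by elim=> //= v l -> r ->. Qed.

HB.instance Definition _ := Choice.copy (tree V) (pcan_type tree_codeK).

End TreeChoice.

Section TreeMonomials.
Variable V : choiceType.
Implicit Types (t u : tree V).

Fixpoint leaves t : seq nat :=
  match t with
  | Leaf i => [:: i]
  | Node _ l r => leaves l ++ leaves r
  end.

Definition arity t : nat := size (leaves t).

Fixpoint nvert t : nat :=
  match t with
  | Leaf _ => 0
  | Node _ l r => (nvert l + nvert r).+1
  end.

Definition minlabel (s : seq nat) : nat := foldr minn (head 0%N s) s.

Definition edge_label t : nat := minlabel (leaves t).

Fixpoint increasing t : bool :=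
  match t with
  | Leaf _ => true
  | Node _ l r =>
      [&& (edge_label l < edge_label r)%N, increasing l & increasing r]
  end.

Definition shuffle_tree t : bool :=
  perm_eq (leaves t) (iota 1 (arity t)) && increasing t.

(* Simultaneous grafting of sigma i on every leaf i; relabellings, shuffle
   compositions and the substitution q|_u are all instances of it. *)
Fixpoint graft (sigma : nat -> tree V) t : tree V :=
  match t with
  | Leaf i => sigma i
  | Node v l r => Node v (graft sigma l) (graft sigma r)
  end.

Definition relabel (lab : nat -> nat) t : tree V :=
  graft (fun i => Leaf (lab i)) t.

(* The relabellings occurring in the shuffle compositions a \o_i b with a of
   arity n and b of arity m: leaf j <> i of a gets label la j, leaf j of b gets
   label lb j, and la i = lb 1 is the minimum of the labels of b.  The pair
   (la, lb) determines the shuffle; results of such compositions of shuffle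
   trees are again shuffle trees. *)
Definition shuffle_labels (n m i : nat) (la lb : nat -> nat) : Prop :=
  [/\ i \in iota 1 n,
      {in iota 1 n &, {homo la : x y / (x < y)%N}},
      {in iota 1 m &, {homo lb : x y / (x < y)%N}},
      la i = lb 1%N
    & perm_eq ([seq la j | j <- iota 1 n & j != i] ++
               [seq lb j | j <- iota 1 m])
              (iota 1 (n + m).-1)].

Definition shuffle_comp (i : nat) (la lb : nat -> nat) (a b : tree V) : tree V :=
  graft (fun j => if j == i then relabel lb b else Leaf (la j)) a.

(* A tree with exactly one star vertex: [Star [:: t1; ..; tn]] is the star
   vertex with its n inputs, and StarL (resp. StarR) are the ordinary vertices
   with the star vertex above their left (resp. right) input. *)
Inductive startree : Type :=
| Star of seq (tree V)
| StarL of V & startree & tree V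
| StarR of V & tree V & startree.

Fixpoint sleaves (q : startree) : seq nat :=
  match q with
  | Star ts => flatten [seq leaves t | t <- ts]
  | StarL _ q' t => sleaves q' ++ leaves t
  | StarR _ t q' => leaves t ++ sleaves q'
  end.

Fixpoint star_arity (q : startree) : nat :=
  match q with
  | Star ts => size ts
  | StarL _ q' _ => star_arity q'
  | StarR _ _ q' => star_arity q'
  end.

Fixpoint sincreasing (q : startree) : bool :=
  match q with
  | Star ts => sorted ltn [seq edge_label t | t <- ts] && all increasing ts
  | StarL _ q' t =>
      [&& (minlabel (sleaves q') < edge_label t)%N, sincreasing q'
        & increasing t]
  | StarR _ t q' =>
      [&& (edge_label t < minlabel (sleaves q'))%N, increasing t
        & sincreasing q']
  end.

Definition shuffle_startree (q : startree) : bool :=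
  perm_eq (sleaves q) (iota 1 (size (sleaves q))) && sincreasing q.

Fixpoint star_subst (q : startree) (u : tree V) : tree V :=
  match q with
  | Star ts => graft (fun i => nth (Leaf 0) ts i.-1) u
  | StarL v q' t => Node v (star_subst q' u) t
  | StarR v t q' => Node v t (star_subst q' u)
  end.

End TreeMonomials.

Section Orders.

Fixpoint lex_lt (T : eqType) (lt : rel T) (s t : seq T) : bool :=
  match s, t with
  | x :: s', y :: t' => if x == y then lex_lt lt s' t' else lt x y
  | _, _ => false
  end.

Definition deglex_lt (T : eqType) (lt : rel T) (s t : seq T) : bool :=
  (size s < size t)%N || (size s == size t) && lex_lt lt s t.

Variables (V : choiceType) (ltV : rel V).
Implicit Types t : tree V.

Fixpoint path_word (i : nat) t : seq V :=
  match t with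
  | Leaf _ => [::]
  | Node v l r => v :: (if i \in leaves l then path_word i l else path_word i r)
  end.

Definition path_seq t : seq (seq V) := [seq path_word i t | i <- iota 1 (arity t)].

(* Entries of leaf sequences are compared with gtn: 1 3 2 < 1 2 3. *)
Definition leaf_lex_path_lt : rel (tree V) := fun t t' =>
  if leaves t == leaves t'
  then lex_lt (deglex_lt ltV) (path_seq t) (path_seq t')
  else deglex_lt gtn (leaves t) (leaves t').

End Orders.

Notation tpoly k V := {freeg (tree V) / k}.

Definition mon {k : fieldType} {V : choiceType} (t : tree V) : tpoly k V := << t >>.

Section GroebnerShirshov.
Variables (k : fieldType) (V : choiceType) (ltT : rel (tree V)).
Implicit Types (f g h : tpoly k V) (t u v w : tree V).

(* The arity n component of the free shuffle operad. *)
Definition in_operad (n : nat) f : Prop :=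
  forall t, t \in dom f -> shuffle_tree t /\ arity t = n.

Definition linext (phi : tree V -> tree V) : tpoly k V -> tpoly k V :=
  fglift (fun t => mon (phi t)).

Definition leading f t : Prop :=
  t \in dom f /\ forall u, u \in dom f -> u != t -> ltT u t.

Definition monic f : Prop := exists2 t, leading f t & coeff t f = 1.

Definition intersection_composition f g w h : Prop :=
  exists fb gb u v i j la lb la' lb',
    [/\ leading f fb, leading g gb,
        [/\ shuffle_tree u, shuffle_tree v & shuffle_tree w],
        [/\ shuffle_labels (arity fb) (arity u) i la lb,
            shuffle_labels (arity v) (arity gb) j la' lb',
            w = shuffle_comp i la lb fb u & w = shuffle_comp j la' lb' v gb]
      & [/\ (maxn (nvert fb) (nvert gb) < nvert w)%N,
            (nvert w < nvert fb + nvert gb)%N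
          & h = linext (fun t => shuffle_comp i la lb t u) f
                - linext (fun t => shuffle_comp j la' lb' v t) g]].

Definition including_composition f g w h : Prop :=
  exists gb q,
    [/\ leading f w, leading g gb,
        shuffle_startree q /\ star_arity q = arity gb,
        w = star_subst q gb & h = f - linext (star_subst q) g].

Definition trivial_mod (S : tpoly k V -> Prop) w h : Prop :=
  exists N (c : 'I_N -> k) (q : 'I_N -> startree V) (s : 'I_N -> tpoly k V),
    (forall i, exists sb,
        [/\ c i != 0, S (s i), leading (s i) sb,
            shuffle_startree (q i) /\ star_arity (q i) = arity sb
          & ltT (star_subst (q i) sb) w])
    /\ h = \sum_i c i *: linext (star_subst (q i)) (s i).

Definition groebner_shirshov_basis (S : tpoly k V -> Prop) : Prop :=
  (forall f, S f -> (exists n, in_operad n f) /\ monic f) /\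
  (forall f g w h, S f -> S g ->
     intersection_composition f g w h \/ including_composition f g w h ->
     trivial_mod S w h).

End GroebnerShirshov.

(* Bilinear extension of (t, u) |-> v(t, u). *)
Definition pnode {k : fieldType} {V : choiceType} (v : V) (f g : tpoly k V) :
    tpoly k V :=
  fglift (fun t => fglift (fun u => mon (Node v t u)) g) f.

Definition pleaf {k : fieldType} {V : choiceType} (i : nat) : tpoly k V :=
  mon (Leaf i).

Variant dsu (V : Type) : Type := Prec of V | Succ of V.

Section DsuChoice.
Variable V : choiceType.
Definition dsu_code (a : dsu V) : V + V :=
  match a with Prec v => inl v | Succ v => inr v end.
Definition dsu_decode (c : V + V) : dsu V :=
  match c with inl v => Prec v | inr v => Succ v end.
Lemma dsu_codeK : cancel dsu_code dsu_decode. Proof. by case. Qed.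
HB.instance Definition _ := Choice.copy (dsu V) (can_type dsu_codeK).
End DsuChoice.

Section DSu.
Variables (k : fieldType) (V : choiceType).

(* The third branch is reached exactly at vertices off the path from the root
   to leaf x. *)
Fixpoint DSu_tree (x : nat) (t : tree V) : tpoly k (dsu V) :=
  match t with
  | Leaf i => pleaf i
  | Node v l r =>
      let l' := DSu_tree x l in
      let r' := DSu_tree x r in
      if x \in leaves l then pnode (Prec v) l' r'
      else if x \in leaves r then pnode (Succ v) l' r'
      else pnode (Prec v) l' r' + pnode (Succ v) l' r'
  end.

Definition DSu (x : nat) : tpoly k V -> tpoly k (dsu V) := fglift (DSu_tree x).

End DSu.

(* Bul' is the opposite operation of Bul. *)
Variant plgen : Type := Bul | Bul'.

Definition plgen_code (a : plgen) : bool := if a is Bul then true else false.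
Definition plgen_decode (b : bool) : plgen := if b then Bul else Bul'.
Lemma plgen_codeK : cancel plgen_code plgen_decode. Proof. by case. Qed.
HB.instance Definition _ := Choice.copy plgen (can_type plgen_codeK).

Definition ldgen : choiceType := dsu plgen.

Definition ldgen_rank (a : ldgen) : nat :=
  match a with
  | Prec Bul => 0
  | Succ Bul => 1
  | Prec Bul' => 2
  | Succ Bul' => 3
  end.

Definition ldgen_lt : rel ldgen := fun a b => (ldgen_rank a < ldgen_rank b)%N.

Section Relations.
Variable k : fieldType.

Section PreLie.
Local Notation b := (@pnode k plgen Bul).
Local Notation b' := (@pnode k plgen Bul').
Local Notation "! i" := (@pleaf k plgen i) (at level 2, format "! i").

Definition RelK : tpoly k plgen :=
  b (b !1 !2) !3 - b !1 (b !2 !3) + b !1 (b' !2 !3) - b (b !1 !3) !2.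
Definition RelS : tpoly k plgen :=
  b (b' !1 !2) !3 - b' !1 (b !2 !3) + b' (b' !1 !3) !2 - b' (b !1 !3) !2.
Definition RelT : tpoly k plgen :=
  b' (b' !1 !2) !3 - b' (b !1 !2) !3 - b' !1 (b' !2 !3) + b (b' !1 !3) !2.

Definition RPreLie : seq (tpoly k plgen) := [:: RelK; RelS; RelT].
End PreLie.

Definition DSu_RPreLie : seq (tpoly k ldgen) :=
  [seq DSu x r | r <- RPreLie, x <- [:: 1; 2; 3]%N].

Section LDend.
Local Notation p := (@pnode k ldgen (Prec Bul)).
Local Notation s := (@pnode k ldgen (Succ Bul)).
Local Notation p' := (@pnode k ldgen (Prec Bul')).
Local Notation s' := (@pnode k ldgen (Succ Bul')).
Local Notation "! i" := (@pleaf k ldgen i) (at level 2, format "! i").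

Definition ast (f g : tpoly k ldgen) : tpoly k ldgen := p f g + s f g.
Definition ast' (f g : tpoly k ldgen) : tpoly k ldgen := p' f g + s' f g.

Definition RLDend : seq (tpoly k ldgen) :=
  [:: p (p !1 !2) !3 - p !1 (ast !2 !3) - p (p !1 !3) !2 + p !1 (ast' !2 !3);
      p (s !1 !2) !3 - s !1 (p !2 !3) - s (ast !1 !3) !2 + s !1 (p' !2 !3);
      s (ast !1 !2) !3 - s !1 (s !2 !3) - p (s !1 !3) !2 + s !1 (s' !2 !3);
      p (p' !1 !2) !3 - p' !1 (ast !2 !3) - p' (p !1 !3) !2 + p' (p' !1 !3) !2;
      p (s' !1 !2) !3 - s' !1 (p !2 !3) - s' (ast !1 !3) !2 + s' (ast' !1 !3) !2;
      s (ast' !1 !2) !3 - s' !1 (s !2 !3) - p' (s !1 !3) !2 + p' (s' !1 !3) !2;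
      p' (p' !1 !2) !3 - p' (p !1 !2) !3 - p' !1 (ast' !2 !3) + p (p' !1 !3) !2;
      p' (s' !1 !2) !3 - p' (s !1 !2) !3 - s' !1 (p' !2 !3) + s (ast' !1 !3) !2;
      s' (ast' !1 !2) !3 - s' (ast !1 !2) !3 - s' !1 (s' !2 !3) + p (s' !1 !3) !2].
End LDend.

End Relations.

Section LDendAlgebras.
Variable k : fieldType.

Definition bilinear_op (A : lmodType k) (op : A -> A -> A) : Prop :=
  (forall x, linear (op x)) /\ (forall y, linear (op ^~ y)).

(* Right L-dendriform algebras. *)
Definition L_dendriform (A : lmodType k) (prec succ : A -> A -> A) : Prop :=
  let ast x y := prec x y + succ x y in
  [/\ bilinear_op prec, bilinear_op succ,
      forall x y z, prec (succ x y) z + succ x (succ z y)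
                    = succ x (prec y z) + succ (ast x z) y
    & forall x y z, prec (prec x y) z + prec x (ast z y)
                    = prec x (ast y z) + prec (prec x z) y].

(* The generators attached to Bul' are determined by the symmetric group
   action: transposing Prec Bul gives Succ Bul', transposing Succ Bul gives
   Prec Bul'. *)
Definition ld_op (A : Type) (prec succ : A -> A -> A) (g : ldgen) : A -> A -> A :=
  match g with
  | Prec Bul => prec
  | Succ Bul => succ
  | Prec Bul' => fun x y => succ y x
  | Succ Bul' => fun x y => prec y x
  end.

Fixpoint eval_tree (A : Type) (op : ldgen -> A -> A -> A) (x : nat -> A)
    (t : tree ldgen) : A :=
  match t with
  | Leaf i => x i
  | Node v l r => op v (eval_tree op x l) (eval_tree op x r)
  end.

(* R is a set of relations of the operad whose algebras are the L-dendriform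
   algebras. *)
Definition relations_of_LDend (R : seq (tpoly k ldgen)) : Prop :=
  forall (A : lmodType k) (prec succ : A -> A -> A),
    L_dendriform prec succ <->
    [/\ bilinear_op prec, bilinear_op succ
      & forall r, r \in R -> forall x : nat -> A,
          fglift (eval_tree (ld_op prec succ) x) r = 0].

End LDendAlgebras.

(* Main.v *)
Require Import Defs.
From mathcomp Require Import all_boot all_algebra.

(* Every leading monomial is a left comb a(b(1,2),3).  It overlaps another one
   c(d(1,2),3) only if b = c, and then only in a(b(d(1,2),3),4), because the two
   combs together force the leaves to increase from left to right.  Including
   compositions vanish because the nine leading monomials are distinct.  The
   sixteen remaining compositions reduce to zero by rewriting, and every step
   uses a coefficient 1 or -1, so the reductions can be computed over the
   integers and hold over every field. *)

Set Implicit Arguments.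
Unset Strict Implicit.
Unset Printing Implicit Defensive.

Import GRing.Theory.
Local Open Scope ring_scope.

(** * Polynomials with integer coefficients, mapped to an arbitrary field *)

Notation zpoly V := (seq (int * tree V)).

Section FreeModule.
Variables (k : fieldType) (V : choiceType).
Implicit Types (s : zpoly V) (t : tree V) (v : V).

(** A list may repeat a monomial or carry a zero coefficient; only the collected coefficients
    matter. *)
Definition poly_of s : tpoly k V := [freeg [seq (x.1%:~R, x.2) | x <- s]].

Definition zscale (c : int) s : zpoly V := [seq (c * x.1, x.2) | x <- s].
Definition zmap (phi : tree V -> tree V) s : zpoly V :=
  [seq (x.1, phi x.2) | x <- s].
Definition znode v s s' : zpoly V :=
  [seq (x.1 * y.1, Node v x.2 y.2) | x <- s, y <- s'].
Definition zcoeff t s : int :=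
  foldr (fun x a => if x.2 == t then x.1 + a else a) 0 s.
Definition zeq s s' : bool :=
  all (fun x => zcoeff x.2 s == zcoeff x.2 s') (s ++ s').

Lemma fglift_poly_of (M : lmodType k) (F : tree V -> M) s :
  fglift F (poly_of s) = \sum_(x <- s) x.1%:~R *: F x.2.
Proof. by rewrite fglift_Freeg /prelift big_map. Qed.

Lemma coeff_poly_of t s : coeff t (poly_of s) = (zcoeff t s)%:~R.
Proof.
rewrite coeff_Freeg /precoeff big_map.
elim: s => [|x s IHs]; first by rewrite big_nil.
by rewrite big_cons IHs /=; case: eqP => // _; rewrite rmorphD.
Qed.

Lemma zcoeff_notin t s : t \notin [seq x.2 | x <- s] -> zcoeff t s = 0.
Proof.
elim: s => //= x s IHs; rewrite inE negb_or eq_sym => /andP[/negbTE-> /IHs].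
by [].
Qed.

(** Only an inclusion: terms may cancel, and a nonzero integer may vanish in [k]. *)
Lemma dom_poly_of s : {subset dom (poly_of s) <= [seq x.2 | x <- s]}.
Proof.
move=> t; rewrite mem_dom coeff_poly_of; apply: contraR => /zcoeff_notin->.
by rewrite eqxx.
Qed.

(** Outside the listed monomials both coefficients are zero, so a finite integer test gives an
    equality over every field. *)
Lemma zeqP s s' : zeq s s' -> poly_of s = poly_of s'.
Proof.
move=> /allP eq_ss'; apply/eqP/freeg_eqP => t; rewrite !coeff_poly_of.
have [/mapP[x /eq_ss'/eqP + ->]|] := boolP (t \in [seq x.2 | x <- s ++ s']).
  by move->.
by rewrite map_cat mem_cat negb_or => /andP[/zcoeff_notin-> /zcoeff_notin->].
Qed.

Lemma poly_of_nil : poly_of [::] = 0.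
Proof. by rewrite /poly_of freeg_nil. Qed.

Lemma addf_poly_of s s' : poly_of s + poly_of s' = poly_of (s ++ s').
Proof. by rewrite /poly_of map_cat freeg_cat. Qed.

Lemma scale_poly_of c s : c%:~R *: poly_of s = poly_of (zscale c s).
Proof.
symmetry; apply/eqP/freeg_eqP => t; rewrite coeffZ !coeff_poly_of -rmorphM; congr _%:~R.
by elim: s => [|x s IHs] /=; rewrite ?mulr0 // IHs; case: eqP; rewrite ?mulrDr.
Qed.

Lemma poly_of_sum s : poly_of s = \sum_(x <- s) x.1%:~R *: mon x.2.
Proof.
elim: s => [|[c t] s IHs]; first by rewrite big_nil poly_of_nil.
rewrite big_cons -cat1s -addf_poly_of IHs; congr (_ + _).
by apply/eqP/freeg_eqP => u; rewrite coeffZ !coeffU mul1r.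
Qed.

Lemma pleaf_poly_of i : pleaf i = poly_of [:: (1, Leaf i)].
Proof. by []. Qed.

Lemma oppf_poly_of s : - poly_of s = poly_of (zscale (-1) s).
Proof. by rewrite -scale_poly_of scaleN1r. Qed.

Lemma pnode_poly_of v s s' :
  pnode v (poly_of s) (poly_of s') = poly_of (znode v s s').
Proof.
rewrite /pnode fglift_poly_of; elim: s => [|x s IHs].
  by rewrite big_nil poly_of_nil.
rewrite big_cons IHs /znode allpairs_cons -addf_poly_of; congr (_ + _).
rewrite fglift_poly_of poly_of_sum big_map scaler_sumr; apply: eq_bigr => y _ /=.
by rewrite scalerA rmorphM.
Qed.

Lemma linext_poly_of (phi : tree V -> tree V) s :
  linext phi (poly_of s) = poly_of (zmap phi s).
Proof. by rewrite /linext fglift_poly_of poly_of_sum big_map. Qed.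

(** Collapses an expression in the generators into a single integer list, after which equalities are
    decided by computation. *)
Definition poly_ofE :=
  (pleaf_poly_of, pnode_poly_of, oppf_poly_of, addf_poly_of, scale_poly_of).

End FreeModule.

Arguments poly_of k {V} s.

(** * The nine relations as integer lists *)

Section Data.
Local Notation p := (Node (Prec Bul : ldgen)).
Local Notation s := (Node (Succ Bul : ldgen)).
Local Notation p' := (Node (Prec Bul' : ldgen)).
Local Notation s' := (Node (Succ Bul' : ldgen)).
Local Notation "! i" := (@Leaf ldgen i) (at level 2, format "! i").

(* The leading monomial comes first in each relation: [zlead] and [reduction]
   rely on it. *)
Definition zRLDend : seq (zpoly ldgen) :=
  [:: [:: (1, p (p !1 !2) !3); (-1, p !1 (p !2 !3)); (-1, p !1 (s !2 !3));
          (-1, p (p !1 !3) !2); (1, p !1 (p' !2 !3)); (1, p !1 (s' !2 !3))];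
      [:: (1, p (s !1 !2) !3); (-1, s !1 (p !2 !3)); (-1, s (p !1 !3) !2);
          (-1, s (s !1 !3) !2); (1, s !1 (p' !2 !3))];
      [:: (1, s (s !1 !2) !3); (1, s (p !1 !2) !3); (-1, s !1 (s !2 !3));
          (-1, p (s !1 !3) !2); (1, s !1 (s' !2 !3))];
      [:: (1, p (p' !1 !2) !3); (-1, p' !1 (p !2 !3)); (-1, p' !1 (s !2 !3));
          (-1, p' (p !1 !3) !2); (1, p' (p' !1 !3) !2)];
      [:: (1, p (s' !1 !2) !3); (-1, s' !1 (p !2 !3)); (-1, s' (p !1 !3) !2);
          (-1, s' (s !1 !3) !2); (1, s' (p' !1 !3) !2); (1, s' (s' !1 !3) !2)];
      [:: (1, s (s' !1 !2) !3); (1, s (p' !1 !2) !3); (-1, s' !1 (s !2 !3));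
          (-1, p' (s !1 !3) !2); (1, p' (s' !1 !3) !2)];
      [:: (1, p' (p' !1 !2) !3); (-1, p' (p !1 !2) !3); (-1, p' !1 (p' !2 !3));
          (-1, p' !1 (s' !2 !3)); (1, p (p' !1 !3) !2)];
      [:: (1, p' (s' !1 !2) !3); (-1, p' (s !1 !2) !3); (-1, s' !1 (p' !2 !3));
          (1, s (p' !1 !3) !2); (1, s (s' !1 !3) !2)];
      [:: (1, s' (s' !1 !2) !3); (1, s' (p' !1 !2) !3); (-1, s' (p !1 !2) !3);
          (-1, s' (s !1 !2) !3); (-1, s' !1 (s' !2 !3)); (1, p (s' !1 !3) !2)]].
End Data.

Lemma RLDend_poly_of k : RLDend k = map (poly_of k) zRLDend.
Proof.
rewrite /RLDend /ast /ast' !poly_ofE.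
do 9! [apply: (f_equal2 cons); first by apply: zeqP; vm_compute].
by [].
Qed.

(** The entries come in blocks of three, from [RelK], [RelS] and [RelT], each for the leaves 1, 2, 3
    in turn; so the two lists match in order. *)
Lemma DSu_RPreLie_RLDend k : DSu_RPreLie k = RLDend k.
Proof.
rewrite RLDend_poly_of /DSu_RPreLie /RPreLie /RelK /RelS /RelT !poly_ofE /=.
do 9! [apply: (f_equal2 cons); first by
  rewrite /DSu fglift_poly_of !(big_cons, big_nil) /= !poly_ofE ?addr0
          ?poly_ofE; apply: zeqP; vm_compute].
by [].
Qed.

(** * Evaluation of the relations in L-dendriform algebras *)

Section Evaluation.
Variable k : fieldType.

Lemma linear_comb (M N : lmodType k) (f : M -> N) (I : Type) (s : seq I)
    (c : I -> k) (g : I -> M) :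
  linear f -> f (\sum_(x <- s) c x *: g x) = \sum_(x <- s) c x *: f (g x).
Proof.
move=> f_lin; elim: s => [|x s IHs]; last by rewrite !big_cons f_lin IHs.
(* [f 0 = 0] follows from linearity by writing 0 as [-1 *: 0 + 0]. *)
by rewrite !big_nil -{1}[0](addNr 0) -scaleN1r f_lin scaleN1r addNr.
Qed.

Lemma fglift_linear (V : choiceType) (M : lmodType k) (F : tree V -> M) :
  linear (fglift F : tpoly k V -> M).
Proof.
have fgliftB : additive (fglift F : tpoly k V -> M) by exact: lift_is_additive.
have fglift0 : fglift F (0 : tpoly k V) = 0 by rewrite -(subrr 0) fgliftB subrr.
have fgliftN f : fglift F (- f) = - fglift F f
  by rewrite -sub0r fgliftB fglift0 sub0r.
move=> a f g; rewrite -[g]opprK fgliftB [in RHS]fgliftN; congr (_ - _).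
rewrite -[f]Freeg_enum; set s := fgenum f.
have -> : a *: [freeg s] = [freeg [seq (a * x.1, x.2) | x <- s]].
  apply/eqP/freeg_eqP => t; rewrite coeffZ !coeff_Freeg /precoeff big_map.
  by rewrite mulr_sumr.
rewrite !fglift_Freeg /prelift big_map scaler_sumr.
by apply: eq_bigr => x _; rewrite scalerA.
Qed.

(** Both arguments are expanded into their monomials, and bilinearity carries [op] through the two
    sums. *)
Lemma fglift_eval_pnode (V : choiceType) (M : lmodType k)
    (E : tree V -> M) (v : V) (op : M -> M -> M) (f g : tpoly k V) :
  bilinear_op op -> (forall t u, E (Node v t u) = op (E t) (E u)) ->
  fglift E (pnode v f g) = op (fglift E f) (fglift E g).
Proof.
move=> [op_linr op_linl] E_node; rewrite -[f]Freeg_enum -[g]Freeg_enum.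
set s := fgenum f; set s' := fgenum g.
rewrite /pnode [in LHS]fglift_Freeg /prelift linear_comb; last exact: fglift_linear.
rewrite !fglift_Freeg /prelift (linear_comb _ _ _ (op_linl _)).
apply: eq_bigr => x _; congr (_ *: _).
rewrite fglift_Freeg /prelift linear_comb; last exact: fglift_linear.
rewrite (linear_comb _ _ _ (op_linr _)); apply: eq_bigr => y _; congr (_ *: _).
by rewrite /mon liftU scale1r E_node.
Qed.

Lemma bilinear_op_flip (A : lmodType k) (op : A -> A -> A) :
  bilinear_op op -> bilinear_op (fun x y => op y x).
Proof. by case=> op_linr op_linl; split. Qed.

Section LDendEvaluation.
Variables (A : lmodType k) (prec succ : A -> A -> A).
Hypotheses (prec_bilin : bilinear_op prec) (succ_bilin : bilinear_op succ).
Variable x : nat -> A.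
Local Notation ev := (fglift (eval_tree (ld_op prec succ) x)).

Lemma ev_pnode v (f g : tpoly k ldgen) :
  ev (pnode v f g) = ld_op prec succ v (ev f) (ev g).
Proof.
apply: fglift_eval_pnode => //.
by case: v => -[] //=; apply: bilinear_op_flip.
Qed.

Lemma ev_pleaf i : ev (pleaf i : tpoly k ldgen) = x i.
Proof. by rewrite /pleaf /mon liftU scale1r. Qed.

Lemma evB (f g : tpoly k ldgen) : ev (f - g) = ev f - ev g.
Proof. exact: lift_is_additive. Qed.

Lemma evD (f g : tpoly k ldgen) : ev (f + g) = ev f + ev g.
Proof. by rewrite -[f]scale1r fglift_linear !scale1r. Qed.

Definition evE := (evB, evD, ev_pnode, ev_pleaf).
End LDendEvaluation.

(** All nine relations have the shape [a - b - c + d]; this turns their vanishing into the two-sided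
    form of the axioms. *)
Lemma subr_addr_eq0 (U : zmodType) (a b c d : U) :
  (a - b - c + d == 0) = (a + d == b + c).
Proof. by rewrite -[RHS]subr_eq0 opprD addrA !(addrAC _ d). Qed.

(** The first, fifth and ninth relations evaluate to the second axiom, the other six to the first
    one, with permuted arguments. Conversely, the second relation yields the first axiom and the
    first relation the second. *)
Lemma relations_of_LDend_RLDend : relations_of_LDend (RLDend k).
Proof.
move=> A prec succ; split=> [[prec_bilin succ_bilin ax1 ax2]|].
  split=> // r + x; rewrite !inE.
  do 8?[case/predU1P=> [->|]]; last move/eqP->; rewrite /ast /ast' !evE //=;
    apply/eqP; rewrite subr_addr_eq0; apply/eqP.
  - by rewrite (addrC (succ (x 3) _)) ax2.
  - by rewrite ax1.
  - by rewrite addrC -ax1 addrC.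
  - by rewrite ax1 addrC.
  - by rewrite (addrC (succ (x 3) _)) ax2 addrC.
  - by rewrite ax1 addrC (addrC (succ (x 2) (x 1))).
  - by rewrite addrC ax1 (addrC (succ (x 3) (x 2))).
  - by rewrite (addrC (succ (x 3) (x 1))) -ax1 addrC.
  - by rewrite addrC (addrC (succ (x 2) (x 1))) ax2.
move=> [prec_bilin succ_bilin rel0]; split=> // x y z.
  (* Leaves are labelled from 1, so entry 0 of the valuation is padding. *)
  have /(rel0 _) /(_ (nth 0 [:: 0; x; y; z])) /eqP : (RLDend k)`_1 \in RLDend k.
    exact: mem_nth.
  by rewrite /= /ast !evE //= subr_addr_eq0 => /eqP.
have /(rel0 _) /(_ (nth 0 [:: 0; x; y; z])) /eqP : (RLDend k)`_0 \in RLDend k.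
  exact: mem_nth.
rewrite /= /ast /ast' !evE //= subr_addr_eq0 => /eqP.
by rewrite (addrC (succ z y)).
Qed.
End Evaluation.

(** * Leading monomials and certificates of triviality *)

Section LeadingMonomials.
Variables (k : fieldType) (V : choiceType) (lt : rel (tree V)).
Implicit Types (s h : zpoly V) (S : seq (zpoly V)) (t u v w : tree V).

Definition zlead s : tree V := (head (0, Leaf 0) s).2.

(* The clause [~~ lt ..] makes the leading monomial unique without assuming that
   [lt] is an order. *)
Definition zleading s : bool :=
  (zcoeff (zlead s) s == 1) &&
  all (fun x => (x.2 == zlead s) || lt x.2 (zlead s) && ~~ lt (zlead s) x.2) s.

Lemma zleading_leading s : zleading s -> leading lt (poly_of k s) (zlead s).
Proof.
move=> /andP[/eqP lead1 /allP lt_lead]; split.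
  by rewrite mem_dom coeff_poly_of lead1 oner_neq0.
move=> u /dom_poly_of/mapP[x /lt_lead + ->].
by case/predU1P=> [->|/andP[]]; first by rewrite eqxx.
Qed.

Lemma zleading_monic s : zleading s -> Defs.monic lt (poly_of k s).
Proof.
move=> lead_s; exists (zlead s); first exact: zleading_leading.
by case/andP: lead_s => /eqP lead1 _; rewrite coeff_poly_of lead1.
Qed.

(** If [t] differed from [zlead s], then [zlead s] would lie below [t], which [zleading] excludes
    for every listed monomial. *)
Lemma leading_zlead s t : zleading s -> leading lt (poly_of k s) t -> t = zlead s.
Proof.
move=> lead_s [/dom_poly_of/mapP[x xs ->] lt_t]; apply/eqP/negPn/negP => neq.
have /andP[_ /allP/(_ _ xs)] := lead_s; rewrite (negbTE neq) /=.
have [dom_lead _] := zleading_leading lead_s.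
by rewrite lt_t ?andbF // eq_sym.
Qed.

(* An entry [(c, q, f)] stands for the summand [c *: q|_f]. *)
Definition certificate : Type := seq (int * startree V * zpoly V).

Definition expansion (c : certificate) : zpoly V :=
  flatten [seq zscale x.1.1 (zmap (star_subst x.1.2) x.2) | x <- c].

(** The coefficients 1 and -1 stay nonzero in every field, so one integer certificate serves all
    characteristics. *)
Definition certifies S w h (c : certificate) : bool :=
  all (fun x => [&& (x.1.1 == 1) || (x.1.1 == -1), x.2 \in S,
                    shuffle_startree x.1.2,
                    star_arity x.1.2 == arity (zlead x.2)
                  & lt (star_subst x.1.2 (zlead x.2)) w]) c
  && zeq h (expansion c).

Lemma poly_of_expansion c :
  poly_of k (expansion c) =
  \sum_(x <- c) x.1.1%:~R *: linext (star_subst x.1.2) (poly_of k x.2).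
Proof.
elim: c => [|x c IHc]; first by rewrite big_nil poly_of_nil.
by rewrite big_cons -IHc linext_poly_of scale_poly_of addf_poly_of.
Qed.

Lemma certifies_trivial_mod S w h c :
  all zleading S -> certifies S w h c ->
  trivial_mod lt (fun f => f \in map (poly_of k) S) w (poly_of k h).
Proof.
move=> /allP leadS /andP[/(@all_tnthP _ _ _ (in_tuple c)) c_ok /zeqP->].
rewrite poly_of_expansion.
pose x i := tnth (in_tuple c) i.
exists (size c), (fun i => (x i).1.1%:~R), (fun i => (x i).1.2),
  (fun i => poly_of k (x i).2); split; last by rewrite big_tnth.
move=> i; exists (zlead (x i).2).
have := c_ok i; rewrite -/(x i).
case/and5P=> pm1 xS q_ok /eqP ar_q lt_q; split=> //.
- by case/orP: pm1 => /eqP->; rewrite ?rmorphN ?oppr_eq0 oner_neq0.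
- exact: map_f.
- exact/zleading_leading/leadS.
Qed.

End LeadingMonomials.

(** * Classification of the compositions of left combs *)

Section Overlaps.
Variables (V : choiceType).
Implicit Types (t u v w : tree V).

Definition left_comb (a b : V) : tree V :=
  Node a (Node b (Leaf 1) (Leaf 2)) (Leaf 3).

Lemma nvert_graft (sigma : nat -> tree V) t :
  nvert (graft sigma t) = (nvert t + \sum_(i <- leaves t) nvert (sigma i))%N.
Proof.
elim: t => [i|c l IHl r IHr] /=; first by rewrite big_seq1.
by rewrite big_cat IHl IHr /= addnACA.
Qed.

Lemma nvert_relabel (lab : nat -> nat) t : nvert (relabel lab t) = nvert t.
Proof. by rewrite nvert_graft big1 ?addn0. Qed.

Lemma graft_eq (sigma tau : nat -> tree V) t :
  {in leaves t, sigma =1 tau} -> graft sigma t = graft tau t.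
Proof.
elim: t => [i|c l IHl r IHr] /= eq_st; first by rewrite eq_st ?mem_head.
by rewrite IHl ?IHr // => i i_t; apply: eq_st; rewrite mem_cat i_t ?orbT.
Qed.

(** Each label of a shuffle tree occurs once, so exactly one leaf receives a copy of [v] and the
    others receive leaves. *)
Lemma nvert_shuffle_comp i la lb u v :
  shuffle_tree u -> shuffle_labels (arity u) (arity v) i la lb ->
  nvert (shuffle_comp i la lb u v) = (nvert u + nvert v)%N.
Proof.
move=> /andP[perm_u _] [i_u _ _ _ _]; rewrite nvert_graft; congr addn.
rewrite (perm_big _ perm_u) (bigD1_seq i) ?iota_uniq //= eqxx nvert_relabel.
by rewrite big1 ?addn0 // => j /negbTE->.
Qed.

Lemma sorted_ltn_iota s n : sorted ltn s -> perm_eq s (iota 1 n) -> s = iota 1 n.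
Proof.
move=> s_sorted /perm_mem; apply: (irr_sorted_eq ltn_trans ltnn) => //.
exact: iota_ltn_sorted.
Qed.

Lemma shuffle_tree_nvert1 t :
  shuffle_tree t -> nvert t = 1%N -> exists c, t = Node c (Leaf 1) (Leaf 2).
Proof.
case: t => [//|c [i|//] [j|//]] /andP[/= perm_ij /andP[lt_ij _]] _.
exists c; have : [:: i; j] = iota 1 2.
  apply: sorted_ltn_iota => //=.
  by move: lt_ij; rewrite /edge_label /minlabel /= !minnn andbT.
by case=> -> ->.
Qed.

Lemma linext_eq (k : fieldType) (phi psi : tree V -> tree V) (f : tpoly k V) :
  {in dom f, phi =1 psi} -> linext phi f = linext psi f.
Proof.
move=> eq_pp; rewrite /linext -[f]Freeg_enum !fglift_Freeg /prelift.
rewrite !big_seq; apply: eq_bigr => x xs; rewrite eq_pp //.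
by apply/mapP; exists x.
Qed.

Lemma linext_id (k : fieldType) (f : tpoly k V) : linext id f = f.
Proof.
rewrite -[f]Freeg_enum /linext fglift_Freeg /prelift.
elim: (fgenum f) => [|[c t] s IHs]; first by rewrite big_nil freeg_nil.
rewrite big_cons IHs -cat1s freeg_cat; congr (_ + _).
by apply/eqP/freeg_eqP => u; rewrite coeffZ !coeffU mul1r.
Qed.

Lemma shuffle_tree_leaves n t i :
  shuffle_tree t -> arity t = n -> i \in leaves t -> i \in iota 1 n.
Proof. by move=> /andP[/perm_mem-> _] ->. Qed.

(** Vertex counts leave one vertex for [u] and for [v], planar shapes fix both grafting positions,
    and order conditions fix all labels. The shuffle compositions thus become substitutions into
    explicit star trees, which can be computed. *)
Lemma intersection_left_comb (k : fieldType) lt (f g h : tpoly k V) w a b c d :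
  in_operad 3 f -> in_operad 3 g ->
  (forall t, leading lt f t -> t = left_comb a b) ->
  (forall t, leading lt g t -> t = left_comb c d) ->
  intersection_composition lt f g w h ->
  [/\ b = c, w = Node a (left_comb b d) (Leaf 4)
    & h = linext (star_subst
                    (Star [:: Node d (Leaf 1) (Leaf 2); Leaf 3; Leaf 4])) f
        - linext (star_subst
                    (StarL a (Star [:: Leaf 1; Leaf 2; Leaf 3]) (Leaf 4))) g].
Proof.
move=> f3 g3 lead_f lead_g [fb [gb [u [v [i [j [la [lb [la' [lb' []]]]]]]]]]].
move=> /[dup] leadf /lead_f fbE /lead_g gbE [sh_u sh_v sh_w].
have sh_fb : shuffle_tree fb by case: (f3 fb (proj1 leadf)).
case=> lab lab' wE wE' [nv_lb nv_ub hE].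
have nv_w := nvert_shuffle_comp sh_fb lab; rewrite -wE in nv_w.
have nv_w' := nvert_shuffle_comp sh_v lab'; rewrite -wE' in nv_w'.
rewrite {}nv_w in nv_lb nv_ub nv_w'.
rewrite {}fbE {}gbE in lab lab' wE wE' nv_lb nv_ub nv_w'.
(* Both combs have two vertices, so the bounds read [2 < 2 + nvert u < 4]. *)
have nv_u : nvert u = 1%N.
  move: nv_lb nv_ub; rewrite /= maxnn !addSn !ltnS.
  by case: (nvert u) => [|[|]].
have nv_v : nvert v = 1%N by apply: (@addIn 2); rewrite -nv_w' nv_u.
have {sh_u nv_u} [e uE] := shuffle_tree_nvert1 sh_u nv_u.
have {sh_v nv_v} [e' vE] := shuffle_tree_nvert1 sh_v nv_v.
clear nv_lb nv_ub nv_w'; subst u v.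
case: lab lab' => i3 la_mono lb_mono la_lb perm_l [j2 la'_mono lb'_mono la'_lb' _].
(* In [fb] composed with [u] the left input of the root is a vertex, which excludes [j = 2]; for
   [j = 1] three vertices lie on the leftmost branch, which forces [i = 1]. *)
have [i1 j1] : i = 1%N /\ j = 1%N.
  move: i3 j2 wE'; rewrite wE /arity /= !inE.
  by move=> /or3P[] /eqP-> /orP[] /eqP->.
subst i j; move: wE'; rewrite wE => -[ae' bc ed lb1 lb2 la2 la3].
(* The outer inequalities come from [lb] and [la]; the middle one, [lb 2 < la 2], is [lb' 2 < lb' 3]
   read in the other factorization. *)
have [lb1E lb2E la2E la3E] : [:: lb 1; lb 2; la 2; la 3]%N = iota 1 4.
  apply: sorted_ltn_iota; last first.
    apply: perm_trans perm_l.
    exact: (permEl (perm_catC [:: lb 1; lb 2]%N [:: la 2; la 3]%N)).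
  by rewrite /= lb_mono // la_mono // lb2 la2 lb'_mono.
split=> //; first by rewrite /shuffle_comp /relabel /= lb1E lb2E la2E la3E ed.
(* The monomials have arity 3, so the maps need to agree only on trees with leaves 1, 2, 3. *)
rewrite hE; congr (_ - _); apply: linext_eq => t.
  move=> /f3[sh_t ar_t]; apply: graft_eq => l /(shuffle_tree_leaves sh_t ar_t).
  rewrite !inE => /or3P[] /eqP->; rewrite /= ?la2E ?la3E //.
  by rewrite /relabel /= lb1E lb2E ed.
move=> /g3[sh_t ar_t]; rewrite /shuffle_comp /= -la3 la3E ae'; congr Node.
apply: graft_eq => l /(shuffle_tree_leaves sh_t ar_t).
by rewrite !inE => /or3P[] /eqP->; rewrite /= -?lb1 -?lb2 -?la2 ?lb1E ?lb2E ?la2E.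
Qed.

Lemma star_subst_neq_Leaf q c l r i :
  Leaf i <> star_subst q (Node c l r : tree V).
Proof. by case: q. Qed.

(** Substituting a two-vertex tree already uses up both vertices of the comb, so [q] is a bare star
    with inputs 1, 2, 3 and acts as the identity. *)
Lemma including_left_comb (k : fieldType) lt (f g h : tpoly k V) w a b c d :
  in_operad 3 g ->
  (forall t, leading lt f t -> t = left_comb a b) ->
  (forall t, leading lt g t -> t = left_comb c d) ->
  including_composition lt f g w h -> [/\ a = c, b = d & h = f - g].
Proof.
move=> g3 lead_f lead_g [_ [q [/lead_f-> /lead_g-> [_ ar_q] qE ->]]].
case: q ar_q qE => [ts|v q t|v t q] /= ar_q qE.
- case: ts ar_q qE => [|t1 [|t2 [|t3 [|]]]] //= _ [-> -> <- <- <-]; split=> //.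
  congr (_ - _); transitivity (linext id g).
    apply: linext_eq => t /g3[sh_t ar_t].
    rewrite -[RHS](_ : graft (@Leaf V) t = t); last first.
      by elim: t {sh_t ar_t} => //= ? ? -> ? ->.
    apply: graft_eq => l /(shuffle_tree_leaves sh_t ar_t).
    by rewrite !inE => /or3P[] /eqP->.
  exact: linext_id.
- move: qE => [_ + _]; case: q {ar_q} => [ts|v' q t'|v' t' q] //= [_].
  + by move=> /star_subst_neq_Leaf.
  + by move=> _ /star_subst_neq_Leaf.
- by case: qE => _ _ /star_subst_neq_Leaf.
Qed.

End Overlaps.

(** * Reduction of the sixteen compositions by rewriting *)

Local Notation lt := (leaf_lex_path_lt ldgen_lt).

Definition comb_ops (s : zpoly ldgen) : ldgen * ldgen :=
  if zlead s is Node a (Node b _ _) _ then (a, b) else (Prec Bul, Prec Bul).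

(** The relation is selected by its leading comb. In a shuffle tree the label of [t1] is already
    below that of [t2], so the test makes the inputs of the star increase. *)
Definition root_redex (t : tree ldgen) : option (startree ldgen * zpoly ldgen) :=
  if t is Node a (Node b t1 t2) t3 then
    if [seq s <- zRLDend | comb_ops s == (a, b)] is s :: _ then
      if (edge_label t2 < edge_label t3)%N then Some (Star [:: t1; t2; t3], s)
      else None
    else None
  else None.

Fixpoint redex (t : tree ldgen) : option (startree ldgen * zpoly ldgen) :=
  if t is Node a l r then
    if root_redex t is Some x then Some x
    else if redex l is Some x then Some (StarL a x.1 r, x.2)
    else if redex r is Some x then Some (StarR a l x.1, x.2)
    else None
  else None.

(** Each step replaces [c] times the leading term by [c] times a multiple of a relation plus [- c]
    times its tail; [n] bounds the depth, and [certifies] checks the resulting list. *)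
Fixpoint reduction (n : nat) (c : int) (t : tree ldgen) : certificate ldgen :=
  if n is n'.+1 then
    if redex t is Some (q, s) then
      (c, q, s) ::
        flatten [seq reduction n' (- c * x.1) (star_subst q x.2) | x <- behead s]
    else [::]
  else [::].

(** The form of the composition found in [intersection_left_comb]. *)
Definition zcomposition (s s' : zpoly ldgen) : zpoly ldgen :=
  let d := (comb_ops s').2 in
  zmap (star_subst (Star [:: Node d (Leaf 1) (Leaf 2); Leaf 3; Leaf 4])) s ++
  zscale (-1)
    (zmap (star_subst (StarL (comb_ops s).1
                         (Star [:: Leaf 1; Leaf 2; Leaf 3]) (Leaf 4))) s').

Definition overlap (s s' : zpoly ldgen) : tree ldgen :=
  Node (comb_ops s).1 (left_comb (comb_ops s).2 (comb_ops s').2) (Leaf 4).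

(* Four rewriting steps bring every monomial of a composition other than the
   overlap itself to normal form. *)
Definition composition_certificate (s s' : zpoly ldgen) : certificate ldgen :=
  flatten [seq reduction 4 x.1 x.2
          | x <- zcomposition s s' & x.2 != overlap s s'].

Lemma zRLDend_zleading : all (zleading lt) zRLDend.
Proof. by vm_compute. Qed.

Lemma zRLDend_left_comb s :
  s \in zRLDend -> zlead s = left_comb (comb_ops s).1 (comb_ops s).2.
Proof.
suff /allP H : all (fun s => zlead s == left_comb (comb_ops s).1 (comb_ops s).2)
    zRLDend.
  by move=> /H/eqP.
by vm_compute.
Qed.

Lemma comb_ops_inj : {in zRLDend &, injective comb_ops}.
Proof.
suff /allrelP H : allrel (fun s s' => (comb_ops s == comb_ops s') ==> (s == s'))
    zRLDend zRLDend.
  by move=> s s' s_in s'_in ops; apply/eqP/(implyP (H _ _ s_in s'_in))/eqP.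
by vm_compute.
Qed.

Lemma zRLDend_in_operad3 (k : fieldType) s : s \in zRLDend -> in_operad 3 (poly_of k s).
Proof.
suff /allP H : all (all (fun x => shuffle_tree x.2 && (arity x.2 == 3))) zRLDend.
  move=> /H/allP s3 t /dom_poly_of/mapP[x /s3/andP[sh_x /eqP ar_x] ->].
  by [].
by vm_compute.
Qed.

Lemma zcomposition_certified s s' :
  s \in zRLDend -> s' \in zRLDend -> (comb_ops s).2 = (comb_ops s').1 ->
  certifies lt zRLDend (overlap s s') (zcomposition s s')
    (composition_certificate s s').
Proof.
suff /allrelP H : allrel (fun s s' =>
    if (comb_ops s).2 == (comb_ops s').1 then
      certifies lt zRLDend (overlap s s') (zcomposition s s')
        (composition_certificate s s')
    else true) zRLDend zRLDend.
  by move=> s_in s'_in ops; have := H s s' s_in s'_in; rewrite ops eqxx.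
by vm_compute.
Qed.

Lemma RLDend_groebner_shirshov (k : fieldType) :
  groebner_shirshov_basis lt (fun f : tpoly k ldgen => f \in RLDend k).
Proof.
rewrite RLDend_poly_of; split=> [_ /mapP[s s_in ->]|].
  split; first by exists 3%N; apply: zRLDend_in_operad3.
  exact/zleading_monic/(allP zRLDend_zleading).
move=> _ _ w h /mapP[s s_in ->] /mapP[s' s'_in ->].
have lead r t : r \in zRLDend -> leading lt (poly_of k r) t ->
    t = left_comb (comb_ops r).1 (comb_ops r).2.
  move=> r_in /(leading_zlead (allP zRLDend_zleading _ r_in))->.
  exact: zRLDend_left_comb.
case.
  case/(intersection_left_comb (zRLDend_in_operad3 s_in)
          (zRLDend_in_operad3 s'_in) (lead _ ^~ s_in) (lead _ ^~ s'_in)).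
  move=> ops -> ->.
  rewrite !linext_poly_of oppf_poly_of addf_poly_of.
  apply: (certifies_trivial_mod k zRLDend_zleading).
  exact: zcomposition_certified.
case/(including_left_comb (zRLDend_in_operad3 s'_in)
        (lead _ ^~ s_in) (lead _ ^~ s'_in)).
move=> ops1 ops2 ->; have -> : s = s'.
  apply: comb_ops_inj => //.
  by rewrite [LHS]surjective_pairing ops1 ops2 -surjective_pairing.
(* The composition is zero, which the empty certificate witnesses. *)
rewrite subrr -poly_of_nil.
exact: (@certifies_trivial_mod _ _ _ _ _ _ [::] zRLDend_zleading).
Qed.

Theorem theorem3p9 (k : fieldType) :
  [/\ DSu_RPreLie k =i RLDend k,
      relations_of_LDend (RLDend k)
    & groebner_shirshov_basis (leaf_lex_path_lt ldgen_lt)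
        (fun f : tpoly k ldgen => f \in RLDend k)].
Proof.
split.
- by rewrite DSu_RPreLie_RLDend.
- exact: relations_of_LDend_RLDend.
- exact: RLDend_groebner_shirshov.
Qed.
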